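(* Let $h>0$ and let $A_h=\frac{1}{h^2}\begin{bmatrix}&-1&\\-1&4&-1\\&-1&\end{bmatrix}$ be the five-point discrete Laplacian on the infinite two-dimensional grid $h\mathbb{Z}^2$. The vertex-wise additive Vanka operator $M_v$ for $A_h$ is given by the stencil $$M_v=\frac{h^2}{240}\begin{bmatrix}0&0&1&0&0\\0&2&8&2&0\\1&8&68&8&1\\0&2&8&2&0\\0&0&1&0&0\end{bmatrix}.$$
   Context: Grid functions are functions $u:h\mathbb{Z}^2\to\mathbb{C}$. A stencil $[s_{\boldsymbol k}]_{\boldsymbol k\in\mathbb{Z}^2}$ (finitely many nonzero entries, the centre entry of the displayed array being $\boldsymbol k=0$) defines the operator $(Su)(\boldsymbol x)=\sum_{\boldsymbol k} s_{\boldsymbol k}\,u(\boldsymbol x+h\boldsymbol k)$. Additive Vanka operator: given a family of finite subsets (patches) $\Upsilon_i$ of the grid whose union is the whole grid, let $V_i$ be the restriction of a grid function to $\Upsilon_i$, $V_i^T$ its transpose (extension by zero), and $A_i=V_iA_hV_i^T$. Then $M=\sum_i V_i^T W_i A_i^{-1}V_i$, where $W_i$ is the diagonal matrix whose entry at each grid point of $\Upsilon_i$ is the reciprocal of the number of patches containing that grid point. The vertex-wise Vanka operator $M_v$ in two dimensions uses as patches each grid point together with its four nearest neighbours, $\{\boldsymbol x-(0,h),\ \boldsymbol x-(h,0),\ \boldsymbol x,\ \boldsymbol x+(h,0),\ \boldsymbol x+(0,h)\}$, $\boldsymbol x\in h\mathbb{Z}^2$ (so, in this ordering, $A_i=\frac{1}{h^2}\begin{pmatrix}4&0&-1&0&0\\0&4&-1&0&0\\-1&-1&4&-1&-1\\0&0&-1&4&0\\0&0&-1&0&4\end{pmatrix}$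 and $W_i=\frac15 I$). *)

(* Defs.v *)
From HB Require Import structures.
From mathcomp Require Import all_boot all_order all_algebra.
From mathcomp Require Import finmap complex.
From mathcomp Require Import boolp classical_sets functions cardinality fsbigop.
From mathcomp Require Import reals.

Set Implicit Arguments.
Unset Strict Implicit.
Unset Printing Implicit Defensive.
Import Order.TTheory GRing.Theory Num.Theory.
Local Open Scope fset_scope.
Local Open Scope classical_set_scope.
Local Open Scope complex_scope.
Local Open Scope ring_scope.

Definition grid (R : realType) (h : R) : set (R * R) :=
  range (fun k : int * int => (h * k.1%:~R, h * k.2%:~R)).

Definition gridFun (R : realType) (h : R) : Type := grid h -> R[i].

Lemma shift_subproof (R : realType) (h : R) (x : grid h) (k : int * int) :
  ((val x).1 + h * k.1%:~R, (val x).2 + h * k.2%:~R) \in grid h.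
Proof.
case: x => x /= /set_mem[j _ <-] /=; apply/mem_set.
by exists (j.1 + k.1, j.2 + k.2) => //=; rewrite !intrD !mulrDr.
Qed.

(* The grid point x + h k. *)
Definition grid_shift (R : realType) (h : R) (x : grid h) (k : int * int) :
    grid h :=
  exist (fun z => z \in grid h) _ (shift_subproof x k).

Definition stencil (R : realType) : Type :=
  {fsfun (int * int) -> R[i] with 0}.

Definition stencil_op (R : realType) (h : R) (s : stencil R) (u : gridFun h) :
    gridFun h :=
  fun x => \sum_(k <- finsupp s) s k * u (grid_shift x k).

(* Offset of the entry in row i, column j of a displayed
   (2r+1) x (2r+1) array: the centre entry has offset 0, columns run in the
   direction of increasing x, and rows, listed from top to bottom, in the
   direction of decreasing y. *)
Definition offset (r i j : nat) : int * int :=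
  (j%:Z - r%:Z, r%:Z - i%:Z).

(* The stencil c [a] displayed as a scalar c times a square array a of odd size,
   given by its rows. Inside the window, row |r - k.2| and column |r + k.1| are
   the ones with offset k. *)
Definition array_stencil (R : realType) (c : R[i]) (a : seq (seq int)) :
    stencil R :=
  let r := (size a)./2 in
  [fsfun k in [fset offset r i j | i in iota 0 r.*2.+1, j in iota 0 r.*2.+1]
     => c * (nth 0 (nth [::] a (absz (r%:Z - k.2))) (absz (r%:Z + k.1)))%:~R].

(* Local finiteness is what gives a meaning to the number of patches containing
   a point, and to the sum over all the patches. *)
Record patch_family (R : realType) (h : R) := PatchFamily {
  patch_index : choiceType;
  patch : patch_index -> {fset grid h};
  patch_cover : forall x, exists i, x \in patch i;
  patch_locally_finite : forall x, finite_set [set i | x \in patch i]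
}.

Arguments patch {R h} p _.

Section Vanka.
Variables (R : realType) (h : R).
Implicit Types (Y : {fset grid h}) (A : gridFun h -> gridFun h).

(* The matrix V of the restriction of a grid function to the patch Y; vectors
   are indexed by an enumeration of the points of Y. *)
Definition restriction Y (u : gridFun h) : 'cV[R[i]]_#|{: Y}| :=
  \col_j u (val (enum_val j)).

(* Its transpose V^T, the extension by zero. *)
Definition extension Y (v : 'cV[R[i]]_#|{: Y}|) : gridFun h :=
  fun x => if insub x is Some y then v (enum_rank (y : Y)) 0 else 0.

(* The matrix V A V^T, column by column. *)
Definition patch_mx A Y : 'M[R[i]]_#|{: Y}| :=
  \matrix_(j, k) restriction Y (A (extension (delta_mx k 0))) j 0.

Definition patch_count (P : patch_family h) (x : grid h) : nat :=
  #|` fset_set [set i | x \in patch P i]|.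

Definition weight_mx (P : patch_family h) (i : patch_index P) :
    'M[R[i]]_#|{: patch P i}| :=
  diag_mx (\row_j (patch_count P (val (enum_val j)))%:R^-1).

(* At each point, only finitely many terms of the sum are nonzero. The matrix
   A_i = patch_mx A (patch P i) is meant to be invertible: invmx returns a
   singular matrix unchanged. *)
Definition vanka (P : patch_family h) A (u : gridFun h) : gridFun h :=
  fun x => \sum_(i \in [set: patch_index P])
    extension (weight_mx i *m invmx (patch_mx A (patch P i))
                 *m restriction (patch P i) u) x.

Definition vertex_patch (x : grid h) : {fset grid h} :=
  [fset grid_shift x (0, -1); grid_shift x (-1, 0); grid_shift x (0, 0);
        grid_shift x (1, 0); grid_shift x (0, 1)].

Lemma shift00 (x : grid h) : grid_shift x (0, 0) = x.
Proof. by apply: val_inj; case: x => -[x1 x2] ? /=; rewrite !mulr0 !addr0. Qed.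

Lemma shiftK (x : grid h) (a b : int) :
  grid_shift (grid_shift x (a, b)) (- a, - b) = x.
Proof.
by apply: val_inj; case: x => -[x1 x2] ? /=; rewrite !intrN !mulrN !addrK.
Qed.

Lemma vertex_patch_cover (x : grid h) : exists i, x \in vertex_patch i.
Proof. by exists x; rewrite !inE shift00 eqxx !orbT. Qed.

Lemma vertex_patch_locally_finite (x : grid h) :
  finite_set [set i | x \in vertex_patch i].
Proof.
apply: (@sub_finite_set _ _ [set` vertex_patch x]); last exact: finite_fset.
move=> y /=; rewrite !inE => /orP[/orP[/orP[/orP[]|]|]|] /eqP ->.
- by have := shiftK y 0 (-1); rewrite oppr0 opprK => ->; rewrite eqxx !orbT.
- by have := shiftK y (-1) 0; rewrite oppr0 opprK => ->; rewrite eqxx !orbT.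
- by rewrite !shift00 eqxx !orbT.
- by have := shiftK y 1 0; rewrite oppr0 => ->; rewrite eqxx !orbT.
- by have := shiftK y 0 1; rewrite oppr0 => ->; rewrite eqxx.
Qed.

Definition vertex_patches : patch_family h :=
  PatchFamily vertex_patch_cover vertex_patch_locally_finite.

End Vanka.

Definition laplacian_stencil (R : realType) (h : R) : stencil R :=
  array_stencil (1 / h ^+ 2)%:C
    [:: [::  0; -1;  0];
        [:: -1;  4; -1];
        [::  0; -1;  0]].

Definition laplacian (R : realType) (h : R) : gridFun h -> gridFun h :=
  stencil_op (laplacian_stencil h).

Definition vertex_vanka (R : realType) (h : R) : gridFun h -> gridFun h :=
  vanka (vertex_patches h) (@laplacian R h).

(* Main.v *)
(** On the patch centred at [y], the system [A_i v = u] is solved by hand: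
    eliminating the four neighbours gives [12 v(y) = h^2 (4 u(y) + N)], where [N]
    is the sum of [u] over the neighbours of [y], and then
    [48 v(x) = h^2 (12 u(x) + 4 u(y) + N)] at each neighbour [x]. Solvability for
    every right-hand side makes [A_i] invertible. The five patches containing a
    given point are the ones centred at the points of its own patch, and
    averaging the five corresponding values gives the stencil. *)

Require Import Defs.
From mathcomp Require Import all_boot all_order all_algebra.
From mathcomp Require Import complex reals.
From mathcomp Require Import finmap boolp classical_sets cardinality.
From mathcomp Require Import fsbigop ring.

Import Order.TTheory GRing.Theory Num.Theory.
Local Open Scope complex_scope.
Local Open Scope ring_scope.

(** The support of the stencil lies in the window, so zero terms extend the sum to the whole window,
    which [offset] enumerates without repetition. *)
Lemma array_stencil_opE (R : realType) (h : R) (c : R[i]) (a : seq (seq int))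
    (u : gridFun h) (x : grid h) :
  stencil_op (array_stencil c a) u x =
  \sum_(i <- iota 0 (size a)./2.*2.+1) \sum_(j <- iota 0 (size a)./2.*2.+1)
    c * (nth 0 (nth [::] a i) j)%:~R *
    u (grid_shift x (offset (size a)./2 i j)).
Proof.
rewrite /stencil_op; set r := (size a)./2; set n := r.*2.+1.
set S := [fset offset r i j | i in iota 0 n, j in iota 0 n]%fset.
have S_supp : (finsupp (array_stencil c a) `<=` S)%fset.
  apply/fsubsetP => k; rewrite mem_finsupp fsfun_fun -/r -/S.
  by case: (k \in S) => //; rewrite eqxx.
rewrite (big_fset_incl _ S_supp); last first.
  by move=> k _; rewrite mem_finsupp negbK => /eqP ->; rewrite mul0r.
rewrite (perm_big _ (enum_imfset2 _ _)); last first.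
  move=> [i j] [i' j'] /= _ _ [] /addIr[->] /addrI /oppr_inj[<-] //.
(* Enumerating the finite predicate [mem (iota 0 n)] unfolds to this [undup]. *)
rewrite big_allpairs_dep -[RHS]/(\sum_(i <- iota 0 n) _).
rewrite -[X in \sum_(i <- X) _ = _]/(undup (iota 0 n)) undup_id ?iota_uniq //.
apply: eq_big_seq => i iI.
rewrite -[X in \sum_(i <- X) _ = _]/(undup (iota 0 n)) undup_id ?iota_uniq //.
apply: eq_big_seq => j jI.
rewrite fsfun_fun -/r -/S in_imfset2 //=.
(* Row and column are recovered from the offset: r - (r - i) = i and r + (j - r) = j. *)
by rewrite subKr addrC subrK.
Qed.

Section Patches.
Variables (R : realType) (h : R).
Implicit Types (Y : {fset grid h}) (u v : gridFun h) (x y : grid h).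

Lemma extensionK Y (w : 'cV[R[i]]_#|{: Y}|) : restriction Y (extension w) = w.
Proof.
apply/matrixP => j k; rewrite mxE /extension valK enum_valK.
by rewrite (ord1 k).
Qed.

Lemma extension_restriction Y u x :
  extension (restriction Y u) x = if x \in Y then u x else 0.
Proof.
rewrite /extension; case: insubP => [z -> <-|/negbTE -> //].
by rewrite mxE enum_rankK.
Qed.

Lemma extensionZ Y (a : R[i]) (w : 'cV[R[i]]_#|{: Y}|) x :
  extension (a *: w) x = a * extension w x.
Proof.
by rewrite /extension; case: insubP => [z _ _|_]; rewrite ?mulr0 // mxE.
Qed.

(** By linearity: [w] is a combination of the basis vectors, whose images are the columns of the
    matrix. *)
Lemma patch_mxE (s : stencil R) Y (w : 'cV[R[i]]_#|{: Y}|) :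
  patch_mx (stencil_op s) Y *m w = restriction Y (stencil_op s (extension w)).
Proof.
apply/matrixP => j k; rewrite (ord1 k) !mxE.
under eq_bigr => i _ do rewrite !mxE /stencil_op mulr_suml.
rewrite exchange_big; apply: eq_bigr => l _ /=.
under eq_bigr => i _ do rewrite -mulrA.
rewrite -mulr_sumr; congr (_ * _); rewrite /extension.
case: insubP => [z _ _|_]; last by rewrite big1 // => i _; rewrite mul0r.
rewrite (bigD1 (enum_rank z)) //= mxE !eqxx mul1r big1 ?addr0 // => i.
by rewrite mxE eq_sym => /negbTE ->; rewrite mul0r.
Qed.

Lemma grid_shiftA x k l : grid_shift (grid_shift x k) l = grid_shift x (k + l).
Proof.
by apply: val_inj; rewrite /= !intrD !mulrDr !addrA.
Qed.

Hypothesis h_neq0 : h != 0.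

Lemma grid_shift_inj x : injective (grid_shift x).
Proof.
move=> [k1 k2] [l1 l2] /(congr1 val) /= [].
move=> /addrI /(mulfI h_neq0) /intr_inj -> /addrI /(mulfI h_neq0).
by move=> /intr_inj ->.
Qed.

Definition axes : seq (int * int) :=
  [:: (0, -1); (-1, 0); (1, 0); (0, 1)].

Lemma perm_vertex_patch x :
  perm_eq (vertex_patch x) [seq grid_shift x k | k <- 0 :: axes].
Proof.
apply: uniq_perm; rewrite ?fset_uniq // ?map_inj_uniq //.
  exact: grid_shift_inj.
move=> z; rewrite /axes /= !inE -!orbA.
by rewrite [X in _ || X = _]orbCA orbCA.
Qed.

Lemma mem_vertex_patch x k :
  (grid_shift x k \in vertex_patch x) = (k \in 0 :: axes).
Proof.
by rewrite (perm_mem (perm_vertex_patch x)) mem_map //; exact: grid_shift_inj.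
Qed.

(** The set of offsets [0 :: axes] is closed under negation, a finite check done by computation. *)
Lemma vertex_patch_sym x y : (x \in vertex_patch y) = (y \in vertex_patch x).
Proof.
suff sub (z t : grid h) : z \in vertex_patch t -> t \in vertex_patch z.
  by apply/idP/idP; exact: sub.
rewrite {1}(perm_mem (perm_vertex_patch t)) => /mapP[k k_ax ->].
have {1}-> : t = grid_shift (grid_shift t k) (- k).
  by rewrite grid_shiftA subrr shift00.
rewrite mem_vertex_patch; move: k k_ax.
by apply/(@allP _ (fun k => - k \in 0 :: axes)).
Qed.

Lemma vertex_patch_count x : patch_count (vertex_patches h) x = 5%N.
Proof.
rewrite /patch_count (_ : [set i | _]%classic = [set` vertex_patch x]%classic).
  by rewrite set_fsetK (perm_size (perm_vertex_patch x)) size_map.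
by apply/seteqP; split=> y /=; rewrite vertex_patch_sym.
Qed.

Let H : R[i] := h%:C.

Let H_neq0 : H != 0.
Proof. by rewrite /H fmorph_eq0. Qed.

(* Offsets are closed terms: evaluating them makes equal grid points
   syntactically equal, as [field] requires. *)
Ltac norm_shifts := repeat match goal with |- context [grid_shift ?x ?k] =>
  let k' := eval vm_compute in k in
  progress change (grid_shift x k) with (grid_shift x k') end.

Lemma laplacianE u x : laplacian u x =
  H ^- 2 * (4 * u x - \sum_(k <- axes) u (grid_shift x k)).
Proof.
(* [norm_shifts] leaves offsets in constructor form, so the zero shift is restated with [Posz 0]. *)
have shift0 : grid_shift x (Posz 0, Posz 0) = x := shift00 x.
rewrite /laplacian /laplacian_stencil array_stencil_opE.
rewrite rmorphM rmorph1 fmorphV rmorphXn -/H /= !big_cons !big_nil /=.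
norm_shifts; rewrite shift0; field.
by [].
Qed.

Definition neighbour_sum u y : R[i] := \sum_(k <- axes) u (grid_shift y k).

(** A function on the whole grid, to be restricted to the patch of [y]; the second branch is the
    value at a neighbour of [y]. *)
Definition star_solution u y : gridFun h := fun x =>
  if x == y then H ^+ 2 / 12 * (4 * u y + neighbour_sum u y)
  else H ^+ 2 / 48 * (12 * u x + 4 * u y + neighbour_sum u y).

Lemma extension_star_solution u y k :
  extension (restriction (vertex_patch y) (star_solution u y)) (grid_shift y k) =
  if k == 0 then H ^+ 2 / 12 * (4 * u y + neighbour_sum u y)
  else if k \in axes then
    H ^+ 2 / 48 * (12 * u (grid_shift y k) + 4 * u y + neighbour_sum u y)
  else 0.
Proof.
rewrite extension_restriction mem_vertex_patch /star_solution.
have -> : (grid_shift y k == y) = (k == 0).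
  by rewrite -[X in _ == X]shift00 (inj_eq (grid_shift_inj y)).
by rewrite in_cons; case: (k == 0).
Qed.

(** Two neighbours of [y] are never adjacent, so the equation at a neighbour involves only its own
    value and the one at [y]. The five points are checked one by one. *)
Lemma laplacian_star_solution u y x : x \in vertex_patch y ->
  laplacian (extension (restriction (vertex_patch y) (star_solution u y))) x
  = u x.
Proof.
have shift0 : grid_shift y (Posz 0, Posz 0) = y := shift00 y.
rewrite (perm_mem (perm_vertex_patch y)) => /mapP[k k_ax ->].
rewrite laplacianE !big_cons big_nil !grid_shiftA !extension_star_solution.
rewrite /neighbour_sum !big_cons big_nil.
move: k_ax; rewrite !in_cons in_nil orbF.
move=> /or4P[|||/orP[]] /eqP ->.
all: by norm_shifts; rewrite ?shift0 /=; field; exact: H_neq0.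
Qed.

Lemma patch_mx_star_unit y :
  patch_mx (@laplacian R h) (vertex_patch y) \in unitmx.
Proof.
set Y := vertex_patch y.
(* The columns of [B] solve the system for the basis vectors; a right inverse of a square matrix
   suffices. *)
pose B : 'M[R[i]]_#|{: Y}| := \matrix_(i, j)
  restriction Y (star_solution (extension (delta_mx j 0)) y) i 0.
suff : patch_mx (@laplacian R h) Y *m B = 1%:M by case/mulmx1_unit.
apply/matrixP => i j.
have -> : (patch_mx (@laplacian R h) Y *m B) i j =
    (patch_mx (@laplacian R h) Y *m
      restriction Y (star_solution (extension (delta_mx j 0)) y)) i 0.
  by rewrite !mxE; apply: eq_bigr => l _; rewrite !mxE.
rewrite patch_mxE -/(@laplacian R h) mxE laplacian_star_solution ?fsvalP //.
have := extensionK Y (delta_mx j 0) => /matrixP /(_ i 0).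
by rewrite !mxE andbT.
Qed.

Lemma patch_solve u y :
  invmx (patch_mx (@laplacian R h) (vertex_patch y))
    *m restriction (vertex_patch y) u =
  restriction (vertex_patch y) (star_solution u y).
Proof.
apply: (canLR (mulKmx (patch_mx_star_unit y))).
rewrite patch_mxE -/(@laplacian R h); apply/matrixP => i j.
by rewrite !mxE laplacian_star_solution ?fsvalP.
Qed.

Lemma vertex_vankaE u x : vertex_vanka u x =
  5^-1 * \sum_(k <- 0 :: axes)
    extension (restriction (vertex_patch (grid_shift x k))
      (star_solution u (grid_shift x k))) x.
Proof.
rewrite /vertex_vanka /vanka.
have weightE y : extension (@weight_mx R h (vertex_patches h) y
      *m invmx (patch_mx (@laplacian R h) (vertex_patch y))
      *m restriction (vertex_patch y) u) x =
    5^-1 * extension (restriction (vertex_patch y) (star_solution u y)) x.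
  rewrite -mulmxA patch_solve -extensionZ; congr (extension _ x).
  rewrite /weight_mx -mul_scalar_mx -diag_const_mx; congr (diag_mx _ *m _).
  by apply/rowP => i; rewrite !mxE vertex_patch_count.
under eq_fsbigr => y _ do rewrite weightE.
(* By symmetry, a patch centred outside the patch of [x] misses [x] and contributes 0; five terms
   remain. *)
rewrite -(fsbig_widen [set` vertex_patch x]%classic) //; last first.
  move=> y [_ /negP]; rewrite vertex_patch_sym => /negbTE x_out.
  by rewrite /= extension_restriction x_out mulr0.
rewrite -fsbig_seq ?fset_uniq // (perm_big _ (perm_vertex_patch x)) big_map.
by rewrite mulr_sumr.
Qed.

Lemma vertex_vanka_stencilE u x : vertex_vanka u x =
  stencil_op (array_stencil (h ^+ 2 / 240%:R)%:C
    [:: [:: 0; 0;  1; 0; 0];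
        [:: 0; 2;  8; 2; 0];
        [:: 1; 8; 68; 8; 1];
        [:: 0; 2;  8; 2; 0];
        [:: 0; 0;  1; 0; 0]]) u x.
Proof.
have shift0 : grid_shift x (Posz 0, Posz 0) = x := shift00 x.
(* Seen from the centre [grid_shift x k], the point [x] has offset [- k], which is the form that
   [extension_star_solution] evaluates. *)
have back k : x = grid_shift (grid_shift x k) (- k).
  by rewrite grid_shiftA subrr shift00.
rewrite vertex_vankaE.
under eq_bigr => k _ do rewrite [X in extension _ X](back k)
  extension_star_solution /neighbour_sum.
rewrite array_stencil_opE rmorphM fmorphV rmorphXn rmorph_nat -/H /=.
rewrite !big_cons !big_nil /= !grid_shiftA.
norm_shifts; rewrite !shift0.
by field.
Qed.

End Patches.

Theorem mainTheorem10 (R : realType) (h : R) (h_gt0 : 0 < h) :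
  @vertex_vanka R h =
  stencil_op (array_stencil (h ^+ 2 / 240%:R)%:C
    [:: [:: 0; 0;  1; 0; 0];
        [:: 0; 2;  8; 2; 0];
        [:: 1; 8; 68; 8; 1];
        [:: 0; 2;  8; 2; 0];
        [:: 0; 0;  1; 0; 0]]).
Proof.
apply/funext => u; apply/funext => x.
exact: vertex_vanka_stencilE (lt0r_neq0 h_gt0) u x.
Qed.
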